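(* Let $S_1$ and $S_2$ be two distinct spheres in $\mathbb{R}^3$, let $\ell_1$ be a line in $\mathbb{R}^3$, and let $\ell_2$ be a line in the plane at infinity that is skew to $\ell_1$. There are infinitely many lines that meet $\ell_1$ and $\ell_2$ and are tangent to $S_1$ and $S_2$ in exactly the following cases (i.e. if and only if (1) or (2) holds). (1) The spheres $S_1$ and $S_2$ are tangent to each other at a point $p$ which lies on $\ell_1$, and $\ell_2$ is the line at infinity in the common tangent plane to the spheres at the point $p$. In this case the lines of the pencil of lines through $p$ that lie in this tangent plane are exactly the common transversals to $\ell_1$ and $\ell_2$ that are also tangent to $S_1$ and $S_2$. (2) Any line meeting $\ell_1$ and $\ell_2$ is perpendicular to $\ell_1$, and $S_1$ and $S_2$ are related to each other by multiplication by $-1$ in the directions perpendicular to $\ell_1$ (in Cartesian coordinates in which $\ell_1$ is the $x$-axis, $S_2$ is the image of $S_1$ under $(x,y,z)\mapsto(x,-y,-z)$).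
   Context: Everything is over the real numbers, in real projective space $\mathbb{P}^3_{\mathbb{R}}=\mathbb{R}^3\cup\{\text{plane at infinity}\}$. Spheres are round spheres in $\mathbb{R}^3$ of positive radius. A line at infinity $\ell_2$ is skew to $\ell_1$ if it does not contain the point at infinity of $\ell_1$. A line of $\mathbb{R}^3$ meets $\ell_2$ iff its point at infinity lies on $\ell_2$, i.e. iff it is parallel to the planes whose line at infinity is $\ell_2$; in (2), ''line meeting $\ell_1$ and $\ell_2$'' refers to such lines of $\mathbb{R}^3$. A transversal to a line is a line meeting it; a line is tangent to a sphere if its distance from the center equals the radius. *)

(* Defs.v *)
From HB Require Import structures.
From mathcomp Require Import all_boot all_order all_algebra.
From mathcomp Require Import boolp classical_sets functions cardinality reals.

Set Implicit Arguments.
Unset Strict Implicit.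
Unset Printing Implicit Defensive.
Import Order.TTheory GRing.Theory Num.Theory.
Local Open Scope ring_scope.
Local Open Scope classical_set_scope.

(* Points, lines and planes of P^3 are the subspaces of R^4 = R^3 x R of
   dimension 1, 2 and 3; a line of R^3 is represented by its projective
   closure. *)
Definition finpt (R : realType) (x : 'rV[R]_3) : 'rV[R]_(3 + 1) :=
  row_mx x 1%:M.

Definition infpt (R : realType) (v : 'rV[R]_3) : 'rV[R]_(3 + 1) :=
  row_mx v 0.

Definition plane_at_infinity (R : realType) : {vspace 'rV[R]_(3 + 1)} :=
  lker (linfun (@rsubmx R 1 3 1)).

Lemma mem_plane_at_infinity (R : realType) (x : 'rV[R]_3) (w : R) :
  (row_mx x w%:M \in plane_at_infinity R) = (w == 0).
Proof.
rewrite memv_ker lfunE /= row_mxKr.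
apply/eqP/eqP => [/matrixP/(_ 0 0) | ->]; first by rewrite !mxE.
by apply/matrixP => i j; rewrite !mxE mul0rn.
Qed.

Definition line (R : realType) (L : {vspace 'rV[R]_(3 + 1)}) : Prop :=
  \dim L = 2%N.

Definition finite_line (R : realType) (L : {vspace 'rV[R]_(3 + 1)}) : Prop :=
  line L /\ ~~ (L <= plane_at_infinity R)%VS.

Definition line_at_infinity (R : realType) (L : {vspace 'rV[R]_(3 + 1)})
  : Prop :=
  line L /\ (L <= plane_at_infinity R)%VS.

Definition meets (R : realType) (L M : {vspace 'rV[R]_(3 + 1)}) : Prop :=
  (L :&: M)%VS != 0%VS.

Definition skew_lines (R : realType) (L M : {vspace 'rV[R]_(3 + 1)}) : Prop :=
  ~ meets L M.

Definition finite_points (R : realType) (L : {vspace 'rV[R]_(3 + 1)})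
  : set 'rV[R]_3 :=
  [set x | finpt x \in L].

Definition dot (R : realType) (u v : 'rV[R]_3) : R := (u *m v^T) 0 0.

Definition enorm (R : realType) (u : 'rV[R]_3) : R := Num.sqrt (dot u u).

Definition dist_to_line (R : realType) (c : 'rV[R]_3)
  (L : {vspace 'rV[R]_(3 + 1)}) : R :=
  inf [set enorm (x - c) | x in finite_points L].

(* A vector v spans the direction of L exactly when infpt v, the point at
   infinity of that direction, lies on L. *)
Definition perpendicular (R : realType) (L M : {vspace 'rV[R]_(3 + 1)})
  : Prop :=
  forall v w : 'rV[R]_3, infpt v \in L -> infpt w \in M -> dot v w = 0.

Definition sphere (R : realType) (c : 'rV[R]_3) (r : R) : set 'rV[R]_3 :=
  [set x | enorm (x - c) = r].

Definition tangent_to_sphere (R : realType) (c : 'rV[R]_3) (r : R)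
  (L : {vspace 'rV[R]_(3 + 1)}) : Prop :=
  dist_to_line c L = r.

(* The plane through p with normal vector n, with homogeneous equation
   <x, n> - w <p, n> = 0 in the coordinates (x, w). *)
Definition plane (R : realType) (p n : 'rV[R]_3) : {vspace 'rV[R]_(3 + 1)} :=
  lker (linfun (mulmxr (col_mx n^T (- (p *m n^T))) : 'rV[R]_(3 + 1) -> 'rV[R]_1)).

Lemma finpt_plane (R : realType) (p n x : 'rV[R]_3) :
  (finpt x \in plane p n) = (dot (x - p) n == 0).
Proof.
rewrite memv_ker lfunE /= /finpt mul_row_col mul1mx -mulmxBl /dot.
apply/eqP/eqP => [-> | h]; first by rewrite mxE.
by apply/matrixP => i j; rewrite !ord1 h mxE.
Qed.

Definition tangent_plane (R : realType) (c p : 'rV[R]_3)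
  : {vspace 'rV[R]_(3 + 1)} :=
  plane p (p - c).

Definition spheres_tangent_at (R : realType) (c1 : 'rV[R]_3) (r1 : R)
  (c2 : 'rV[R]_3) (r2 : R) (p : 'rV[R]_3) : Prop :=
  [/\ sphere c1 r1 p, sphere c2 r2 p & tangent_plane c1 p = tangent_plane c2 p].

(* The image of A under multiplication by -1 in the directions perpendicular
   to L: q is the foot of the perpendicular from x to L, and
   x = q + (x - q) is sent to q - (x - q). *)
Definition half_turn_image (R : realType) (L : {vspace 'rV[R]_(3 + 1)})
  (A : set 'rV[R]_3) : set 'rV[R]_3 :=
  [set y | exists x q : 'rV[R]_3,
    [/\ A x, finite_points L q,
        forall v, infpt v \in L -> dot (x - q) v = 0
      & y = q - (x - q)]].

Lemma half_turn_image_x_axis (R : realType) (L : {vspace 'rV[R]_(3 + 1)})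
  (A : set 'rV[R]_3) :
  finite_points L = [set x | x 0 1 = 0 /\ x 0 2 = 0] ->
  half_turn_image L A =
    [set \row_j (if j == 0 then x 0 j else - x 0 j) | x in A].
Proof.
move=> hL.
have L0 : finpt (0 : 'rV[R]_3) \in L.
  by have : finite_points L 0 by rewrite hL /= !mxE.
have LP v : (infpt v \in L) <-> finite_points L v.
  have -> : infpt v = finpt v - finpt 0.
    by rewrite /finpt opp_row_mx add_row_mx subr0 subrr.
  by rewrite /finite_points /= (rpredBr _ L0).
have dotE (u v : 'rV[R]_3) :
    dot u v = u 0 0 * v 0 0 + u 0 1 * v 0 1 + u 0 2 * v 0 2.
  rewrite /dot !mxE !big_ord_recl big_ord0 addr0 addrA !mxE.
  by congr (_ * v 0 _ + u 0 _ * v 0 _ + u 0 _ * v 0 _); apply/val_inj.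
have ordP (j : 'I_3) : [\/ j = 0, j = 1 | j = 2].
  case: j => -[|[|[|//]]] i; [constructor 1|constructor 2|constructor 3];
  exact/val_inj.
apply/seteqP; split => y /=.
  move=> [x [q [Ax qL xq ->]]]; exists x => //.
  move: (qL); rewrite hL /= => -[q1 q2].
  have := xq (delta_mx 0 0); rewrite LP hL /= !mxE => /(_ (conj erefl erefl)).
  rewrite dotE !mxE /= mulr1 !mulr0 !addr0 => /subr0_eq x0.
  apply/rowP => j; rewrite !mxE.
  case: (ordP j) => -> /=; first by rewrite x0 subrr subr0.
    by rewrite q1 subr0 add0r.
  by rewrite q2 subr0 add0r.
move=> [x Ax <-]; exists x, (x 0 0 *: delta_mx 0 0); split => //.
- by rewrite hL /= !mxE /= mulr0.
- move=> v; rewrite LP hL /= => -[v1 v2].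
  by rewrite dotE v1 v2 !mulr0 !addr0 !mxE /= mulr1 subrr mul0r.
- apply/rowP => j; rewrite !mxE.
  case: (ordP j) => -> /=; first by rewrite mulr1 subrr subr0.
    by rewrite mulr0 subr0 add0r.
  by rewrite mulr0 subr0 add0r.
Qed.

Definition common_tangents (R : realType) (l1 l2 : {vspace 'rV[R]_(3 + 1)})
  (c1 : 'rV[R]_3) (r1 : R) (c2 : 'rV[R]_3) (r2 : R)
  : set {vspace 'rV[R]_(3 + 1)} :=
  [set L | [/\ finite_line L, meets L l1, meets L l2,
               tangent_to_sphere c1 r1 L & tangent_to_sphere c2 r2 L]].

Definition tangency_case (R : realType) (l1 l2 : {vspace 'rV[R]_(3 + 1)})
  (c1 : 'rV[R]_3) (r1 : R) (c2 : 'rV[R]_3) (r2 : R) (p : 'rV[R]_3) : Prop :=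
  [/\ spheres_tangent_at c1 r1 c2 r2 p,
      finite_points l1 p
    & l2 = (tangent_plane c1 p :&: plane_at_infinity R)%VS].

Definition half_turn_case (R : realType) (l1 l2 : {vspace 'rV[R]_(3 + 1)})
  (c1 : 'rV[R]_3) (r1 : R) (c2 : 'rV[R]_3) (r2 : R) : Prop :=
  (forall L, finite_line L -> meets L l1 -> meets L l2 -> perpendicular L l1)
  /\ sphere c2 r2 = half_turn_image l1 (sphere c1 r1).

(* Main.v *)
Require Import Defs.
From HB Require Import structures.
From mathcomp Require Import all_boot all_order all_algebra.
From mathcomp Require Import ring lra.
From mathcomp Require Import boolp classical_sets functions cardinality reals.
Set Implicit Arguments.
Unset Strict Implicit.
Unset Printing Implicit Defensive.
Import Order.TTheory GRing.Theory Num.Theory.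
Local Open Scope ring_scope.
Local Open Scope classical_set_scope.

(** Call the planes through [l2] horizontal. Since [l2] is skew to [l1],
   each horizontal plane cuts [l1] in one point, and a common transversal is
   a line of the pencil through that point in that plane. So the common
   transversals are parametrized by a height [t] and a direction [p : q]
   ([transversal_lineP]), and in an orthonormal frame adapted to [l1] and
   [l2] ([exists_adapted_frame]) tangency to a sphere is one equation in
   [t], [p], [q] ([tangent_transversal]). For [p = 1] it is a quadratic
   equation [A * t ^+ 2 - 2 * B * t + C = 0], where [A], [B], [C] are
   polynomials of degree at most 2 in [q] and where [A] is positive and does
   not depend on the sphere.

   Each direction carries at most two transversals tangent to a given sphere.
   Hence if there are infinitely many common tangents, every polynomial in
   [q] that vanishes at all common solutions is zero
   ([infinite_dense_slopes]), and everything reduces to identities between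
   polynomials.

   Because [A] is shared, the difference of the two equations is linear in [t].
   If it involves [t], then [t] is a rational function of [q], so the
   discriminant [B ^+ 2 - A * C] of either equation is the square of a
   rational function. But the discriminant always contains the factor
   [1 + q ^+ 2], which is irreducible over the reals: it occurs twice, and
   this means precisely that the sphere touches a horizontal plane at a
   point of [l1] ([touches_of_dense]). Two such spheres with infinitely many
   common tangents touch the same horizontal plane at the same point
   ([touching_pair]): this is the tangency case. If the difference is free
   of [t], comparing coefficients shows that the spheres are equal or that
   [l1] is perpendicular to the horizontal planes and the half turn about
   [l1] exchanges the spheres ([eq_polar_dense]): this is the half-turn
   case.

   Conversely, in the tangency case all lines of the pencil through the point
   of contact are solutions, and no others, since the two equations subtract
   to a nonzero multiple of the height above the tangent plane
   ([tangency_case_pencil]); in the half-turn case the two equations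
   coincide and are solved by a curve of lines ([half_turn_infinite]). *)

(** * Lines, planes and spheres *)

Lemma dotE (R : realType) (u v : 'rV[R]_3) : dot u v = \sum_j u 0 j * v 0 j.
Proof. by rewrite /dot mxE; apply: eq_bigr => j _; rewrite mxE. Qed.

Lemma dotC (R : realType) (u v : 'rV[R]_3) : dot u v = dot v u.
Proof. by rewrite !dotE; apply: eq_bigr => j _; rewrite mulrC. Qed.

Lemma dotDl (R : realType) (u v w : 'rV[R]_3) :
  dot (u + v) w = dot u w + dot v w.
Proof. by rewrite /dot mulmxDl mxE. Qed.

Lemma dotZl (R : realType) k (u w : 'rV[R]_3) : dot (k *: u) w = k * dot u w.
Proof. by rewrite /dot -scalemxAl mxE. Qed.

Lemma dotDr (R : realType) (u v w : 'rV[R]_3) :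
  dot w (u + v) = dot w u + dot w v.
Proof. by rewrite ![dot w _]dotC dotDl. Qed.

Lemma dotZr (R : realType) k (u w : 'rV[R]_3) : dot w (k *: u) = k * dot w u.
Proof. by rewrite ![dot w _]dotC dotZl. Qed.

Lemma dot_affine (R : realType) (w v : 'rV[R]_3) s :
  dot (w + s *: v) (w + s *: v)
  = dot w w + 2 * s * dot w v + s ^+ 2 * dot v v.
Proof. by rewrite dotDl !dotDr !dotZl !dotZr (dotC v w); ring. Qed.

Lemma dot_ge0 (R : realType) (u : 'rV[R]_3) : 0 <= dot u u.
Proof. by rewrite dotE sumr_ge0// => j _; rewrite -expr2 sqr_ge0. Qed.

Lemma dot_eq0 (R : realType) (u : 'rV[R]_3) : (dot u u == 0) = (u == 0).
Proof.
apply/idP/eqP => [|->]; last by rewrite /dot mul0mx mxE.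
rewrite dotE psumr_eq0 => [/allP h|j _]; last by rewrite -expr2 sqr_ge0.
apply/rowP => j; rewrite mxE; apply/eqP; rewrite -sqrf_eq0 expr2.
by apply: h; rewrite mem_index_enum.
Qed.

Lemma sphereP (R : realType) (c x : 'rV[R]_3) (r : R) :
  0 <= r -> sphere c r x <-> dot (x - c) (x - c) = r ^+ 2.
Proof.
move=> r0; rewrite /sphere /enorm /=; split=> [<-|->].
  by rewrite sqr_sqrtr ?dot_ge0.
by rewrite sqrtr_sqr ger0_norm.
Qed.

Definition span_line (R : realType) (x v : 'rV[R]_3)
  : {vspace 'rV[R]_(3 + 1)} :=
  (<[finpt x]> + <[infpt v]>)%VS.

Lemma homogeneousP (R : realType) (w : 'rV[R]_(3 + 1)) :
  exists y k, w = row_mx y k%:M.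
Proof.
exists (lsubmx w), (rsubmx w 0 0); rewrite -[LHS]hsubmxK; congr row_mx.
by apply/matrixP => i j; rewrite !ord1 !mxE eqxx mulr1n.
Qed.

Lemma infptE (R : realType) (v : 'rV[R]_3) : infpt v = row_mx v 0%:M.
Proof.
by rewrite /infpt; congr row_mx; apply/matrixP => i j; rewrite !mxE mul0rn.
Qed.

Lemma infpt_eq0 (R : realType) (v : 'rV[R]_3) : (infpt v == 0) = (v == 0).
Proof.
by rewrite -row_mx0; apply/eqP/eqP => [/eq_row_mx[]|->].
Qed.

Lemma infptZ (R : realType) k (v : 'rV[R]_3) : k *: infpt v = infpt (k *: v).
Proof. by rewrite /infpt scale_row_mx scaler0. Qed.

Lemma infptD (R : realType) (u v : 'rV[R]_3) :
  infpt u + infpt v = infpt (u + v).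
Proof. by rewrite /infpt add_row_mx addr0. Qed.

Lemma infpt_plane_at_infinity (R : realType) (v : 'rV[R]_3) :
  infpt v \in plane_at_infinity R.
Proof. by rewrite infptE mem_plane_at_infinity. Qed.

Lemma mem_span_line (R : realType) (x v y : 'rV[R]_3) k :
  row_mx y k%:M \in span_line x v <-> exists s, y = k *: x + s *: v.
Proof.
split=> [/memv_addP[_ /vlineP[k' ->] [_ /vlineP[s ->]]]|[s ->]].
  rewrite /finpt /infpt !scale_row_mx add_row_mx.
  move=> /eq_row_mx[-> /matrixP/(_ 0 0)].
  by rewrite !mxE /= mulr1n mulr0 addr0 mulr1 => ->; exists s.
apply/memv_addP; exists (k *: finpt x); first by rewrite memvZ ?memv_line.
exists (s *: infpt v); first by rewrite memvZ ?memv_line.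
by rewrite /finpt /infpt !scale_row_mx add_row_mx scalemx1 scaler0 addr0.
Qed.

Lemma finpt_span_line (R : realType) (x v y : 'rV[R]_3) :
  finpt y \in span_line x v <-> exists s, y = x + s *: v.
Proof.
by rewrite /finpt mem_span_line; split=> -[s ->]; exists s; rewrite scale1r.
Qed.

Lemma infpt_span_line (R : realType) (x v y : 'rV[R]_3) :
  infpt y \in span_line x v <-> exists s, y = s *: v.
Proof.
by rewrite infptE mem_span_line; split=> -[s ->]; exists s;
  rewrite scale0r add0r.
Qed.

Lemma finpt_eq0 (R : realType) (x : 'rV[R]_3) : (finpt x == 0) = false.
Proof.
apply/eqP; rewrite -row_mx0 => /eq_row_mx[_ /matrixP/(_ 0 0)/eqP].
by rewrite !mxE oner_eq0.
Qed.

Lemma line_span_line (R : realType) (x v : 'rV[R]_3) :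
  v != 0 -> line (span_line x v).
Proof.
move=> v0; rewrite /line /span_line dimv_disjoint_sum; last first.
  apply/eqP; rewrite -subv0; apply/subvP => w; rewrite memv_cap.
  case/andP => /vlineP[k ->] /vlineP[s].
  rewrite /finpt /infpt !scale_row_mx => /eq_row_mx[_ /matrixP/(_ 0 0)].
  by rewrite !mxE /= mulr1n mulr0 mulr1 => ->; rewrite !scale0r row_mx0 mem0v.
by rewrite !dim_vline finpt_eq0 infpt_eq0 v0.
Qed.

Lemma span_line_eq (R : realType) (L : {vspace 'rV[R]_(3 + 1)})
  (x v : 'rV[R]_3) :
  line L -> v != 0 -> finpt x \in L -> infpt v \in L -> L = span_line x v.
Proof.
move=> lineL v0 xL vL; apply/eqP; rewrite eq_sym eqEdim lineL line_span_line//.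
by rewrite subv_add -!memvE xL vL.
Qed.

Lemma finite_span_line (R : realType) (x v : 'rV[R]_3) :
  v != 0 -> finite_line (span_line x v).
Proof.
move=> v0; split; first exact: line_span_line.
apply/subvPn; exists (finpt x); last by rewrite mem_plane_at_infinity oner_eq0.
by apply/finpt_span_line; exists 0; rewrite scale0r addr0.
Qed.

Lemma finpt_normalize (R : realType) (y : 'rV[R]_3) k :
  k != 0 -> finpt (k^-1 *: y) = k^-1 *: row_mx y k%:M.
Proof. by move=> k0; rewrite /finpt scale_row_mx scale_scalar_mx mulVf. Qed.

Lemma finite_line_point (R : realType) (L : {vspace 'rV[R]_(3 + 1)}) :
  finite_line L -> exists x, finpt x \in L.
Proof.
move=> [_ /subvPn[w wL]]; have [y [k wE]] := homogeneousP w.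
rewrite wE mem_plane_at_infinity => k0; exists (k^-1 *: y).
by rewrite finpt_normalize// -wE memvZ.
Qed.

(** Clearing the last coordinate of a second point of [L] by means of
   [finpt x] pushes it to infinity. *)
Lemma line_inf_point (R : realType) (L : {vspace 'rV[R]_(3 + 1)}) x :
  line L -> finpt x \in L -> exists2 v, v != 0 & infpt v \in L.
Proof.
move=> lineL xL.
have /subvPn[w wL] : ~~ (L <= <[finpt x]>)%VS.
  by apply/negP => /dimvS; rewrite lineL dim_vline finpt_eq0.
have [y [k wE]] := homogeneousP w; move=> wx.
have dE : infpt (y - k *: x) = w - k *: finpt x.
  by rewrite wE /infpt /finpt scale_row_mx opp_row_mx add_row_mx scalemx1 subrr.
exists (y - k *: x); last by rewrite dE memvB// memvZ.
rewrite -infpt_eq0 dE subr_eq0; apply: contraNneq wx => ->.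
by rewrite memvZ// memv_line.
Qed.

Lemma finite_lineP (R : realType) (L : {vspace 'rV[R]_(3 + 1)}) x :
  line L -> finpt x \in L -> exists2 v, v != 0 & L = span_line x v.
Proof.
move=> lineL xL; have [v v0 vL] := line_inf_point lineL xL.
by exists v => //; apply: span_line_eq.
Qed.

(** The squared distance from [c] to [x + s *: v] is a quadratic polynomial
   in [s]. Completing the square exhibits its minimum, so the infimum
   defining the distance to the line is attained and tangency becomes
   polynomial. *)
Lemma tangent_span_line (R : realType) (c x v : 'rV[R]_3) (r : R) :
  v != 0 -> 0 <= r ->
  tangent_to_sphere c r (span_line x v) <->
  dot (x - c) (x - c) * dot v v - dot (x - c) v ^+ 2 = r ^+ 2 * dot v v.
Proof.
move=> v0 r0; set w := x - c.
have vv0 : dot v v != 0 by rewrite dot_eq0.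
have vv_gt0 : 0 < dot v v by rewrite lt_neqAle eq_sym vv0 dot_ge0.
(* The minimum [D] of the squared distance is reached at [s0]. *)
pose s0 := - (dot w v / dot v v); pose D := dot w w - dot w v ^+ 2 / dot v v.
have distE s :
    dot (x + s *: v - c) (x + s *: v - c) = D + (s - s0) ^+ 2 * dot v v.
  rewrite addrAC -/w dot_affine /D /s0; field.
  exact: vv0.
have D0 : 0 <= D.
  have := distE s0; rewrite subrr expr0n mul0r addr0 => <-; exact: dot_ge0.
have -> : tangent_to_sphere c r (span_line x v) <-> Num.sqrt D = r.
  rewrite /tangent_to_sphere.
  suff -> : dist_to_line c (span_line x v) = Num.sqrt D by [].
  rewrite /dist_to_line; set E := [set _ | _ in _].
  have ED : E (Num.sqrt D).
    exists (x + s0 *: v); first by apply/finpt_span_line; exists s0.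
    by rewrite /enorm distE subrr expr0n mul0r addr0.
  have lbD : lbound E (Num.sqrt D).
    move=> _ [_ /finpt_span_line[s ->] <-].
    rewrite /enorm distE ler_wsqrtr// lerDl mulr_ge0 ?sqr_ge0 ?ltW//.
  apply/le_anti/andP; split; first by apply: ge_inf => //; exists (Num.sqrt D).
  by apply: lb_le_inf => //; exists (Num.sqrt D).
have -> : dot w w * dot v v - dot w v ^+ 2 = D * dot v v.
  by rewrite /D; field.
split=> [<-|/(mulIf vv0) ->]; first by rewrite sqr_sqrtr.
by rewrite sqrtr_sqr ger0_norm.
Qed.

Lemma mem_plane (R : realType) (p n y : 'rV[R]_3) k :
  (row_mx y k%:M \in plane p n) = (dot y n == k * dot p n).
Proof.
rewrite memv_ker lfunE /= mul_row_col mulmxN mul_scalar_mx subr_eq0.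
apply/eqP/eqP => [/matrixP/(_ 0 0)|h]; first by rewrite [RHS]mxE.
by apply/matrixP => i j; rewrite !ord1 [RHS]mxE.
Qed.

Lemma plane_scale (R : realType) (p n : 'rV[R]_3) k :
  k != 0 -> plane p (k *: n) = plane p n.
Proof.
move=> k0; apply/vspaceP => w; have [y [s ->]] := homogeneousP w.
by rewrite !mem_plane !dotZr mulrCA (inj_eq (mulfI k0)).
Qed.

(** For every [v] of norm [r] the points [c + v] and [c - v] are equidistant
   from [c'], so [c - c'] is orthogonal to all such [v]. *)
Lemma sphere_inj (R : realType) (c c' : 'rV[R]_3) r r' :
  0 < r -> 0 < r' -> sphere c r = sphere c' r' -> c = c' /\ r = r'.
Proof.
move=> r0 r'0 E.
have [r_ge0 r'_ge0] := (ltW r0, ltW r'0).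
have sph s v : s ^+ 2 = 1 -> dot v v = r ^+ 2 ->
    dot (c - c') (c - c') + 2 * s * dot (c - c') v + r ^+ 2 = r' ^+ 2.
  move=> s1 vr; have : sphere c r (c + s *: v).
    apply/sphereP => //.
    by rewrite addrC addKr dotZl dotZr mulrA -expr2 s1 mul1r.
  by rewrite E => /(sphereP _ _ r'_ge0); rewrite addrAC dot_affine s1 vr mul1r.
have orth v : dot v v = r ^+ 2 ->
    dot (c - c') v = 0 /\ dot (c - c') (c - c') + r ^+ 2 = r' ^+ 2.
  move=> vr; have h1 := sph 1 v (expr1n _ _) vr.
  have h2 := sph (-1) v (sqrr_sign _ 1) vr.
  by split; lra.
have cE : c = c'.
  apply/eqP; rewrite -subr_eq0; apply/eqP/rowP => j; rewrite [RHS]mxE.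
  have [|+ _] := orth (r *: delta_mx 0 j).
    rewrite dotZl dotZr /dot trmx_delta mul_delta_mx mxE !eqxx mulr1.
    by rewrite expr2.
  rewrite dotZr => /eqP; rewrite mulf_eq0 gt_eqF//= => /eqP.
  by rewrite /dot trmx_delta -colE mxE.
split=> //; have [|_] := orth (r *: delta_mx 0 0).
  by rewrite dotZl dotZr /dot trmx_delta mul_delta_mx mxE !eqxx mulr1 expr2.
rewrite cE subrr; have /eqP-> : dot (0 : 'rV[R]_3) 0 == 0 by rewrite dot_eq0.
by rewrite add0r => /eqP; rewrite eqrXn2// => /eqP.
Qed.

(** * Orthonormal frames adapted to the two lines *)

Definition vec3 (R : realType) (F : 'M[R]_3) (x y z : R) : 'rV[R]_3 :=
  x *: row 0 F + y *: row 1 F + z *: row 2 F.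

Lemma vec3D (R : realType) (F : 'M[R]_3) x y z x' y' z' :
  vec3 F x y z + vec3 F x' y' z' = vec3 F (x + x') (y + y') (z + z').
Proof. by apply/rowP => j; rewrite !mxE; ring. Qed.

Lemma vec3Z (R : realType) (F : 'M[R]_3) k x y z :
  k *: vec3 F x y z = vec3 F (k * x) (k * y) (k * z).
Proof. by apply/rowP => j; rewrite !mxE; ring. Qed.

Lemma vec3N (R : realType) (F : 'M[R]_3) x y z :
  - vec3 F x y z = vec3 F (- x) (- y) (- z).
Proof. by apply/rowP => j; rewrite !mxE; ring. Qed.

Lemma sum_ord3 (V : nmodType) (f : 'I_3 -> V) : \sum_i f i = f 0 + f 1 + f 2.
Proof.
rewrite !big_ord_recl big_ord0 addr0 addrA.
by congr (_ + f _ + f _); apply/val_inj.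
Qed.

Lemma dot_row (R : realType) (F : 'M[R]_3) i j :
  F *m F^T = 1%:M -> dot (row i F) (row j F) = (i == j)%:R.
Proof.
move=> FF; have /matrixP/(_ i j) := FF; rewrite !mxE => <-.
by rewrite dotE; apply: eq_bigr => k _; rewrite !mxE.
Qed.

Lemma dot_vec3 (R : realType) (F : 'M[R]_3) x y z x' y' z' :
  F *m F^T = 1%:M ->
  dot (vec3 F x y z) (vec3 F x' y' z') = x * x' + y * y' + z * z'.
Proof.
move=> FF; rewrite /vec3 !dotDl !dotDr !dotZl !dotZr !dot_row//=; ring.
Qed.

Lemma vec3_coord (R : realType) (F : 'M[R]_3) (w : 'rV[R]_3) :
  F *m F^T = 1%:M ->
  w = vec3 F (dot w (row 0 F)) (dot w (row 1 F)) (dot w (row 2 F)).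
Proof.
move=> FF.
have -> : vec3 F (dot w (row 0 F)) (dot w (row 1 F)) (dot w (row 2 F))
    = w *m F^T *m F.
  apply/rowP => j; rewrite !mxE sum_ord3 !mxE !dotE.
  by congr (_ * _ + _ * _ + _ * _); apply: eq_bigr => k _; rewrite !mxE.
by rewrite -mulmxA (mulmx1C FF) mulmx1.
Qed.

Lemma vec3_inj (R : realType) (F : 'M[R]_3) x y z x' y' z' :
  F *m F^T = 1%:M -> vec3 F x y z = vec3 F x' y' z' ->
  [/\ x = x', y = y' & z = z'].
Proof.
move=> FF E; have D a b c := congr1 (fun w => dot w (vec3 F a b c)) E.
by move: (D 1 0 0) (D 0 1 0) (D 0 0 1); rewrite !dot_vec3// => *; split; lra.
Qed.

Lemma point_coord (R : realType) (a : 'rV[R]_3) F c :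
  F *m F^T = 1%:M -> exists x y z, c = a + vec3 F x y z.
Proof.
move=> FF; have := vec3_coord (c - a) FF.
set x := dot _ _; set y := dot _ _; set z := dot _ _ => cE.
by exists x, y, z; rewrite -cE addrC subrK.
Qed.

(** Two linear conditions on three unknowns. *)
Lemma exists_normal (R : realType) (v1 v2 : 'rV[R]_3) :
  exists n : 'rV[R]_3, [/\ n != 0, dot n v1 = 0 & dot n v2 = 0].
Proof.
pose M := row_mx v1^T v2^T.
have /rowV0Pn[n nM n0] : kermx M != 0.
  rewrite kermx_eq0 /row_free; apply/negP => /eqP h.
  by have := rank_leq_col M; rewrite h.
exists n; split=> //; move/sub_kermxP: nM.
  by rewrite mul_mx_row -[0]row_mx0 => /eq_row_mx[h _]; rewrite /dot h mxE.
by rewrite mul_mx_row -[0]row_mx0 => /eq_row_mx[_ h]; rewrite /dot h mxE.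
Qed.

Lemma exists_unit_normal (R : realType) (v1 v2 : 'rV[R]_3) :
  exists n : 'rV[R]_3, [/\ dot n n = 1, dot n v1 = 0 & dot n v2 = 0].
Proof.
have [n [n0 n1 n2]] := exists_normal v1 v2.
have s0 : Num.sqrt (dot n n) != 0.
  by rewrite sqrtr_eq0 -ltNge lt_neqAle eq_sym dot_eq0 n0 dot_ge0.
exists ((Num.sqrt (dot n n))^-1 *: n); rewrite !dotZl n1 n2 !mulr0; split=> //.
rewrite dotZr -{3}(sqr_sqrtr (dot_ge0 n)); field; exact: s0.
Qed.

(** The third vector is orthogonal to [v1] and [v2], the first to the third
   and to [u]; the second vector completes them. *)
Lemma exists_orthonormal_frame (R : realType) (v1 v2 u : 'rV[R]_3) :
  exists F : 'M[R]_3, [/\ F *m F^T = 1%:M, dot v1 (row 2 F) = 0,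
    dot v2 (row 2 F) = 0 & dot u (row 0 F) = 0].
Proof.
have [n [nn n1 n2]] := exists_unit_normal v1 v2.
have [f [ff fn fu]] := exists_unit_normal n u.
have [g [gg gn gf]] := exists_unit_normal n f.
pose F : 'M[R]_3 := \matrix_(i, j) [:: f; g; n]`_i 0 j.
have F0 : row 0 F = f by apply/rowP => j; rewrite !mxE.
have F1 : row 1 F = g by apply/rowP => j; rewrite !mxE.
have F2 : row 2 F = n by apply/rowP => j; rewrite !mxE.
exists F; rewrite F0 F2; split; rewrite 1?dotC//.
have FE i j : (F *m F^T) i j = dot (row i F) (row j F).
  by rewrite mxE dotE; apply: eq_bigr => k _; rewrite !mxE.
have ordP (j : 'I_3) : [\/ j = 0, j = 1 | j = 2].
  case: j => -[|[|[|//]]] i; [constructor 1|constructor 2|constructor 3];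
  exact/val_inj.
apply/matrixP => i j; rewrite FE mxE.
by case: (ordP i) => ->; case: (ordP j) => ->; rewrite ?F0 ?F1 ?F2 //= dotC.
Qed.

(** The rows of [F] are an orthonormal basis of which the first two vectors
   span the directions of [l2]. Since [l1] is skew to [l2], its direction
   has a nonzero third coordinate, normalised here to 1. The first
   coordinate can be made 0 by choosing the first vector orthogonal to [l1]:
   this leaves one number [e], the tangent of the angle between [l1] and the
   third vector, and makes all later algebra depend on a single parameter
   besides the two spheres. *)
Record adapted_frame (R : realType) (l1 l2 : {vspace 'rV[R]_(3 + 1)})
  (a : 'rV[R]_3) (F : 'M[R]_3) (e : R) : Prop := AdaptedFrame {
  adapted_orthonormal : F *m F^T = 1%:M;
  adapted_line : l1 = span_line a (vec3 F 0 e 1);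
  adapted_line_at_infinity :
    l2 = (<[infpt (vec3 F 1 0 0)]> + <[infpt (vec3 F 0 1 0)]>)%VS }.

Lemma mem_adapted_line_at_infinity (R : realType)
  (l1 l2 : {vspace 'rV[R]_(3 + 1)}) a F e w :
  adapted_frame l1 l2 a F e ->
  w \in l2 <-> exists p q, w = infpt (vec3 F p q 0).
Proof.
move=> [_ _ ->]; split=> [/memv_addP[_ /vlineP[p ->] [_ /vlineP[q ->] ->]]|].
  exists p, q; rewrite !infptZ infptD !vec3Z vec3D.
  by congr (infpt (vec3 _ _ _ _)); ring.
move=> [p [q ->]].
have -> : vec3 F p q 0 = p *: vec3 F 1 0 0 + q *: vec3 F 0 1 0.
  by rewrite !vec3Z vec3D; congr vec3; ring.
by rewrite -infptD -!infptZ memv_add// memvZ// memv_line.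
Qed.

Lemma infpt_of_mem (R : realType) (w : 'rV[R]_(3 + 1)) :
  w \in plane_at_infinity R -> exists v, w = infpt v.
Proof.
have [v [k ->]] := homogeneousP w; rewrite mem_plane_at_infinity => /eqP->.
by exists v; rewrite infptE.
Qed.

Lemma meetsP (R : realType) (L M : {vspace 'rV[R]_(3 + 1)}) :
  Defs.meets L M <-> exists w, [/\ w != 0, w \in L & w \in M].
Proof.
rewrite /Defs.meets -subv0; split=> [/subvPn[w]|[w [w0 wL wM]]].
  by rewrite memv_cap memv0 => /andP[wL wM] w0; exists w.
by apply/subvPn; exists w; rewrite ?memv_cap ?wL// memv0.
Qed.

Lemma exists_adapted_frame (R : realType) (l1 l2 : {vspace 'rV[R]_(3 + 1)}) a :
  finite_line l1 -> line_at_infinity l2 -> skew_lines l1 l2 -> finpt a \in l1 ->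
  exists F e, adapted_frame l1 l2 a F e.
Proof.
move=> [linel1 _] [linel2 l2inf] skew al1.
have [u u0 l1E] := finite_lineP linel1 al1.
have ul1 : infpt u \in l1.
  by rewrite l1E; apply/infpt_span_line; exists 1; rewrite scale1r.
have [v1 [v2 vl2]] : exists v1 v2, forall w, w \in l2 -> exists p q,
    w = infpt (p *: v1 + q *: v2).
  have := vbasisP l2; have := size_tuple (vbasis l2).
  case: (vbasis l2) => /= s _; rewrite linel2.
  case: s => [|w1 [|w2 [|]]]//= _ bas.
  have /infpt_of_mem[v1 w1E] : w1 \in plane_at_infinity R.
    by apply: (subvP l2inf); apply: (basis_mem bas); rewrite !inE eqxx.
  have /infpt_of_mem[v2 w2E] : w2 \in plane_at_infinity R.
    by apply: (subvP l2inf); apply: (basis_mem bas); rewrite !inE eqxx orbT.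
  exists v1, v2 => w; rewrite -(span_basis bas) span_cons span_seq1.
  move=> /memv_addP[_ /vlineP[p ->] [_ /vlineP[q ->] ->]].
  by exists p, q; rewrite w1E w2E !infptZ infptD.
have [F [FF n1 n2 f1u]] := exists_orthonormal_frame v1 v2 u.
have l2E : l2 = (<[infpt (vec3 F 1 0 0)]> + <[infpt (vec3 F 0 1 0)]>)%VS.
  apply/eqP; rewrite eqEdim; apply/andP; split.
    apply/subvP => w /vl2[p [q ->]].
    have := vec3_coord (p *: v1 + q *: v2) FF.
    rewrite [dot _ (row 2 F)]dotDl !dotZl n1 n2 !mulr0 addr0.
    set x := dot _ _; set y := dot _ _ => ->.
    have -> : vec3 F x y 0 = x *: vec3 F 1 0 0 + y *: vec3 F 0 1 0.
      by rewrite !vec3Z vec3D; congr vec3; ring.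
    by rewrite -infptD -!infptZ memv_add// memvZ// memv_line.
  rewrite linel2; apply: leq_trans (dimv_add_leqif _ _) _.
  by rewrite !dim_vline; do 2 case: (_ == 0).
pose x := dot u (row 1 F); pose z := dot u (row 2 F).
have uE : u = vec3 F 0 x z by rewrite {1}(vec3_coord u FF) f1u.
have z0 : z != 0.
  apply/eqP => z0; apply: skew; apply/meetsP; exists (infpt u).
  split=> //; first by rewrite infpt_eq0.
  rewrite l2E uE z0.
  have -> : vec3 F 0 x 0 = 0 *: vec3 F 1 0 0 + x *: vec3 F 0 1 0.
    by rewrite !vec3Z vec3D; congr vec3; ring.
  by rewrite -infptD -!infptZ memv_add// memvZ// memv_line.
have u1 : vec3 F 0 (x / z) 1 = z^-1 *: u.
  by rewrite uE vec3Z; congr vec3; field.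
exists F, (x / z); split=> //; apply: span_line_eq => //.
  by rewrite u1 scaler_eq0 invr_eq0 negb_or z0.
by rewrite u1 -infptZ memvZ.
Qed.

(** The height [t] of the point on [l1] and the direction [p : q] in the
   planes through [l2] parametrize the common transversals. *)
Definition transversal_line (R : realType) (a : 'rV[R]_3) (F : 'M[R]_3)
  (e t p q : R) : {vspace 'rV[R]_(3 + 1)} :=
  span_line (a + vec3 F 0 (t * e) t) (vec3 F p q 0).

Lemma vec3_pq_eq0 (R : realType) (F : 'M[R]_3) p q : F *m F^T = 1%:M ->
  (vec3 F p q 0 == 0) = (p ^+ 2 + q ^+ 2 == 0).
Proof.
by move=> FF; rewrite -dot_eq0 dot_vec3// mulr0 addr0 !expr2.
Qed.

(** A common transversal meets [l1] at a finite point: if it met [l1] at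
   infinity, its points on [l1] and [l2], which differ because [l1] and [l2]
   are skew, would span a line at infinity. *)
Lemma transversal_lineP (R : realType) (l1 l2 L : {vspace 'rV[R]_(3 + 1)})
  a F e :
  adapted_frame l1 l2 a F e -> skew_lines l1 l2 ->
  [/\ finite_line L, Defs.meets L l1 & Defs.meets L l2] <->
  exists t p q, p ^+ 2 + q ^+ 2 != 0 /\ L = transversal_line a F e t p q.
Proof.
move=> fr skew; have FF := adapted_orthonormal fr.
have al1 t : finpt (a + vec3 F 0 (t * e) t) \in l1.
  rewrite (adapted_line fr); apply/finpt_span_line; exists t.
  by rewrite vec3Z !mulr0 mulr1.
split=> [[[lineL Linf] /meetsP[w [w0 wL wl1]] /meetsP[w' [w'0 w'L w'l2]]]|].
  have [p [q w'E]] := (mem_adapted_line_at_infinity _ fr).1 w'l2.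
  have pq0 : p ^+ 2 + q ^+ 2 != 0.
    by rewrite -(vec3_pq_eq0 _ _ FF) -infpt_eq0 -w'E.
  have [y [k wE]] := homogeneousP w; have [k0|k0] := eqVneq k 0.
    have wiE : w = infpt y by rewrite wE k0 infptE.
    case/negP: Linf; suff <- : (<[w]> + <[w']>)%VS = L.
      by rewrite subv_add -!memvE wiE w'E !infpt_plane_at_infinity.
    apply/eqP; rewrite eqEdim subv_add -!memvE wL w'L lineL.
    rewrite dimv_disjoint_sum ?dim_vline ?w0 ?w'0//.
    apply/eqP; rewrite -subv0; apply/subvP => v; rewrite memv_cap memv0.
    case/andP => /vlineP[c ->] /vlineP[d].
    have [->|c0 E] := eqVneq c 0; first by rewrite scale0r.
    case: skew; apply/meetsP; exists w; split=> //.
    by rewrite -[w](scalerK c0) E !memvZ.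
  have yl1 : finpt (k^-1 *: y) \in l1 by rewrite finpt_normalize// -wE memvZ.
  have yL : finpt (k^-1 *: y) \in L by rewrite finpt_normalize// -wE memvZ.
  move: yl1; rewrite (adapted_line fr) => /finpt_span_line[t yE].
  exists t, p, q; split=> //; apply: span_line_eq => //.
  - by rewrite vec3_pq_eq0.
  - by move: yL; rewrite yE vec3Z mulr0 mulr1.
  - by rewrite -w'E.
move=> [t [p [q [pq0 ->]]]]; have v0 : vec3 F p q 0 != 0 by rewrite vec3_pq_eq0.
split; first exact: finite_span_line.
- apply/meetsP; exists (finpt (a + vec3 F 0 (t * e) t)); rewrite finpt_eq0 al1.
  by split=> //; apply/finpt_span_line; exists 0; rewrite scale0r addr0.
- apply/meetsP; exists (infpt (vec3 F p q 0)); rewrite infpt_eq0; split=> //.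
    by apply/infpt_span_line; exists 1; rewrite scale1r.
  by apply/(mem_adapted_line_at_infinity _ fr); exists p, q.
Qed.

(** In coordinates centred at a point of [l1]: in the plane at height [t],
   the sphere with centre [(x, y, z)] and radius [r] cuts a circle of
   squared radius [r ^+ 2 - (t - z) ^+ 2], and the first square divided by
   [p ^+ 2 + q ^+ 2] is the squared distance from the centre of that circle
   to the transversal. *)
Definition tangency_form (R : realType) (e x y z r t p q : R) : R :=
  (x * q + (t * e - y) * p) ^+ 2 + ((t - z) ^+ 2 - r ^+ 2) * (p ^+ 2 + q ^+ 2).

Lemma tangent_transversal (R : realType) (a : 'rV[R]_3) F e x y z r t p q :
  F *m F^T = 1%:M -> p ^+ 2 + q ^+ 2 != 0 -> 0 <= r ->
  tangent_to_sphere (a + vec3 F x y z) r (transversal_line a F e t p q) <->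
  tangency_form e x y z r t p q = 0.
Proof.
move=> FF pq0 r0; rewrite tangent_span_line ?vec3_pq_eq0//.
rewrite opprD addrACA subrr add0r vec3N vec3D !dot_vec3//.
set lhs := (X in X = _ <-> _); set rhs := (X in _ = X <-> _).
have -> : tangency_form e x y z r t p q = lhs - rhs.
  by rewrite /tangency_form /lhs /rhs; ring.
by split=> [->|/eqP]; rewrite ?subrr// subr_eq0 => /eqP.
Qed.

Lemma common_tangentsP (R : realType) (l1 l2 : {vspace 'rV[R]_(3 + 1)})
  a F e
  x1 y1 z1 r1 x2 y2 z2 r2 L :
  adapted_frame l1 l2 a F e -> skew_lines l1 l2 -> 0 <= r1 -> 0 <= r2 ->
  common_tangents l1 l2 (a + vec3 F x1 y1 z1) r1 (a + vec3 F x2 y2 z2) r2 L <->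
  exists t p q, [/\ p ^+ 2 + q ^+ 2 != 0, L = transversal_line a F e t p q,
    tangency_form e x1 y1 z1 r1 t p q = 0 &
    tangency_form e x2 y2 z2 r2 t p q = 0].
Proof.
move=> fr skew r10 r20; have FF := adapted_orthonormal fr; split.
  move=> [finL mL1 mL2 t1 t2].
  have [t [p [q [pq0 LE]]]] :=
    (transversal_lineP _ fr skew).1 (And3 finL mL1 mL2).
  exists t, p, q; split=> //.
    by move: t1; rewrite LE => /tangent_transversal->.
  by move: t2; rewrite LE => /tangent_transversal->.
move=> [t [p [q [pq0 -> f1 f2]]]].
have [|finL mL1 mL2] :=
  (transversal_lineP (transversal_line a F e t p q) fr skew).2.
  by exists t, p, q.
by split=> //; apply/tangent_transversal.
Qed.

(** * Polynomials over a field *)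

Lemma poly_roots_finite (F : fieldType) (P : {poly F}) :
  P != 0 -> exists s : seq F, forall x, root P x -> x \in s.
Proof.
elim: {P}(size P) {-2}P (leqnn (size P)) => [|n IH] P.
  by rewrite leqn0 size_poly_eq0 => /eqP->; rewrite eqxx.
move=> sP P0; have [[a Pa]|noroot] := pselect (exists a, root P a); last first.
  by exists [::] => x Px; case: noroot; exists x.
have /factor_theorem[Q PQ] := Pa.
have Q0 : Q != 0 by apply: contra_neq P0 => Q0; rewrite PQ Q0 mul0r.
have [|//|s hs] := IH Q.
  by move: sP; rewrite PQ size_Mmonic ?monicXsubC// size_XsubC addn2.
exists (a :: s) => x; rewrite PQ rootM root_XsubC inE => /orP[/hs->|->//].
by rewrite orbT.
Qed.

(** Irreducible polynomials are prime, so the multiplicity of [d] in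
   [d * P * B ^+ 2] would be odd if [d] did not divide [P]. *)
Lemma irreducible_dvd_of_square (F : fieldType) (d P B X : {poly F}) :
  irreducible_poly d -> B != 0 -> X ^+ 2 = d * P * B ^+ 2 -> d %| P.
Proof.
move=> irr; have [sd _] := irr.
have d0 : d != 0 by rewrite -size_poly_gt0 ltnW.
have prime_d U V : d %| U * V -> d %| U \/ d %| V.
  move=> dUV; have [|ndU] := boolP (d %| U); [by left|right].
  by rewrite -(@Gauss_dvdpr _ _ U)// irreducible_poly_coprime.
have sq U : d %| U ^+ 2 -> d %| U.
  by rewrite expr2 => /prime_d[].
elim: {B}(size B) {-2}B (leqnn (size B)) X => [|n IH] B.
  by rewrite leqn0 size_poly_eq0 => /eqP->; rewrite eqxx.
move=> sB X B0 XE.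
have /dvdpP[Y YE] : d %| X by apply: sq; rewrite XE -mulrA dvdp_mulIl.
have {}YE : d * Y ^+ 2 = P * B ^+ 2.
  by apply: (mulfI d0); rewrite [RHS]mulrA -XE YE; ring.
have /prime_d[//|/sq/dvdpP[B' B'E]] : d %| P * B ^+ 2 by rewrite -YE dvdp_mulIl.
have B'0 : B' != 0 by apply: contra_neq B0 => h; rewrite B'E h mul0r.
apply: (IH B' _ Y B'0).
  rewrite -ltnS; apply: leq_trans sB; rewrite B'E size_mul//.
  by move: sd; case: (size d) => [|[|k]]// _;
    rewrite addnS /= addnS ltnS leq_addr.
by apply: (mulfI d0); rewrite YE B'E; ring.
Qed.

Lemma irreducible_X2_add1 (R : realFieldType) :
  irreducible_poly (1 + 'X^2 : {poly R}).
Proof.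
have sz : size (1 + 'X^2 : {poly R}) = 3.
  by rewrite addrC size_polyDl ?size_polyXn// size_poly1.
apply: cubic_irreducible; first by rewrite sz.
move=> x; rewrite /root !hornerE; by rewrite gt_eqF// ltr_wpDr// sqr_ge0.
Qed.

(** * Pairs of tangency equations with many common solutions *)

(** The sphere is tangent to the plane at height [t] at the point where [l1]
   crosses that plane. When both spheres do this at the same height, they
   are tangent to each other at a point of [l1]. *)
Definition touches (R : realType) (e x y z r t : R) : Prop :=
  [/\ x = 0, y = t * e & (t - z) ^+ 2 = r ^+ 2].

(** The projection of [Z] to the second variable is Zariski dense in the
   affine line. This is how the infinitude of the solutions is used: an
   equation that they satisfy becomes an identity between polynomials. *)
Definition dense_slopes (R : realType) (Z : R -> R -> Prop) : Prop :=
  forall P : {poly R}, (forall t q, Z t q -> root P q) -> P = 0.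

(** With [p = 1] the tangency form is [A * t ^+ 2 - 2 * B * t + C], where
   [A = e ^+ 2 + 1 + q ^+ 2] is the same for all spheres, [B] is
   [polar_poly] and [C] is [const_poly], both evaluated at [q]. *)
Definition polar_poly (R : realType) (e x y z : R) : {poly R} :=
  z *: (1 + 'X^2) - e *: (x *: 'X - y%:P).

Definition const_poly (R : realType) (x y z r : R) : {poly R} :=
  (x *: 'X - y%:P) ^+ 2 + (z ^+ 2 - r ^+ 2) *: (1 + 'X^2).

(** For [w = z * e - y], the product of the dividend and [1 + 'X^2] is a
   quarter of the discriminant in [t] of a tangency form. Modulo [1 + 'X^2]
   the variable becomes an imaginary unit [i], and the remainder has the
   real and the imaginary part of [(r * e) ^+ 2 - (w + x * i) ^+ 2] as
   coefficients. If these vanish, then [w + x * i] is [r * e] or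
   [- r * e]. *)
Lemma dvd_discriminant (R : realType) (x w r e : R) :
  (1 + 'X^2 : {poly R}) %| r ^+ 2 *: ((e ^+ 2 + 1)%:P + 'X^2)
                            - (x *: 'X + w%:P) ^+ 2 ->
  r != 0 -> x = 0 /\ w ^+ 2 = (r * e) ^+ 2.
Proof.
have szd : size (1 + 'X^2 : {poly R}) = 3.
  by rewrite addrC size_polyDl ?size_polyXn// size_poly1.
set d : {poly R} := 1 + 'X^2 in szd *.
have -> : r ^+ 2 *: ((e ^+ 2 + 1)%:P + 'X^2) - (x *: 'X + w%:P) ^+ 2 =
    (r ^+ 2 - x ^+ 2) *: d
    + (((r * e) ^+ 2 + x ^+ 2 - w ^+ 2)%:P - (2 * x * w) *: 'X).
  rewrite /d -!mul_polyC; ring.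
rewrite dvdp_addr; last by rewrite -mul_polyC dvdp_mulIr.
set rem := _ - _ => drem r0.
have rem0 : rem = 0.
  apply/eqP; apply: contraTT drem => rem0; rewrite gtNdvdp// szd ltnS.
  rewrite (leq_trans (size_polyD _ _))// geq_max size_polyN.
  rewrite (leq_trans (size_polyC_leq1 _))//=.
  by rewrite (leq_trans (size_scale_leq _ _))// size_polyX.
have r1 : rem.[1] = 0 by rewrite rem0 horner0.
have r2 : rem.[-1] = 0 by rewrite rem0 horner0.
move: r1 r2; rewrite /rem !hornerE => r1 r2.
have xw : x * w = 0 by lra.
have e2 : (r * e) ^+ 2 + x ^+ 2 = w ^+ 2 by lra.
have x0 : x = 0.
  move/eqP: xw; rewrite mulf_eq0 => /orP[/eqP//|/eqP w0].
  move: e2; rewrite w0 expr0n /= => /eqP.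
  by rewrite paddr_eq0 ?sqr_ge0// [x ^+ 2 == 0]sqrf_eq0 => /andP[_ /eqP].
by split=> //; rewrite -e2 x0 expr0n addr0.
Qed.

(** Subtracting the two tangency equations leaves [2 * B * t = C], where [B]
   and [C] are now the differences of the coefficients. Eliminating [t]
   shows that [B ^+ 2] times the discriminant of the first equation is a
   square. That discriminant has the factor [1 + 'X^2], which is irreducible
   over the reals, so this factor must occur in the discriminant a second
   time, and this forces the sphere to touch one of the horizontal planes at
   a point of [l1]. *)
Lemma touches_of_dense (R : realType) (e x1 y1 z1 r1 x2 y2 z2 r2 : R) :
  r1 != 0 ->
  dense_slopes (fun t q => tangency_form e x1 y1 z1 r1 t 1 q = 0 /\
                           tangency_form e x2 y2 z2 r2 t 1 q = 0) ->
  polar_poly e x1 y1 z1 != polar_poly e x2 y2 z2 ->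
  exists g, touches e x1 y1 z1 r1 g.
Proof.
move=> r0 dense; rewrite -subr_eq0.
set B := _ - _ => B0.
pose A : {poly R} := (e ^+ 2 + 1)%:P + 'X^2.
pose C := const_poly x1 y1 z1 r1 - const_poly x2 y2 z2 r2.
pose Q := r1 ^+ 2 *: A - (x1 *: 'X + (z1 * e - y1)%:P) ^+ 2.
have id0 : (A * C - 2 *: polar_poly e x1 y1 z1 * B) ^+ 2
     = (1 + 'X^2) * Q * (2 *: B) ^+ 2.
  apply/eqP; rewrite -subr_eq0; apply/eqP/dense => t q.
  rewrite /tangency_form => -[f1 f2]; rewrite /root /Q /C /A /B.
  rewrite /polar_poly /const_poly !hornerE /=; apply/eqP.
  pose b1 := z1 * (1 + q ^+ 2) - e * (x1 * q - y1).
  pose b2 := z2 * (1 + q ^+ 2) - e * (x2 * q - y2).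
  pose a := e ^+ 2 + 1 + q ^+ 2.
  pose k1 := (x1 * q - y1) ^+ 2 + (z1 ^+ 2 - r1 ^+ 2) * (1 + q ^+ 2).
  pose k2 := (x2 * q - y2) ^+ 2 + (z2 ^+ 2 - r2 ^+ 2) * (1 + q ^+ 2).
  have E1 : a * t ^+ 2 - 2 * b1 * t + k1 = 0 by rewrite -f1 /a /b1 /k1; ring.
  have E2 : k1 - k2 = 2 * t * (b1 - b2).
    by apply/eqP; rewrite -subr_eq0 -[X in _ == X](subrr 0) -{1}f1 -f2;
      apply/eqP; rewrite /b1 /b2 /k1 /k2; ring.
  (* In this form, [k1 - k2 = 2 * t * (b1 - b2)] turns the square into that of
     [2 * (b1 - b2) * (a * t - b1)], and [(a * t - b1) ^+ 2 = b1 ^+ 2 - a * k1]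
     by the first equation. *)
  transitivity ((a * (k1 - k2) - 2 * b1 * (b1 - b2)) ^+ 2
                - (b1 ^+ 2 - a * k1) * (2 * (b1 - b2)) ^+ 2).
    by rewrite /a /b1 /b2 /k1 /k2; ring.
  by rewrite E2 (_ : k1 = 2 * b1 * t - a * t ^+ 2); [ring|lra].
have [|x0 w2] := @dvd_discriminant R x1 (z1 * e - y1) r1 e _ r0.
  apply: (irreducible_dvd_of_square (irreducible_X2_add1 R) _ id0).
  by rewrite scaler_eq0 negb_or pnatr_eq0.
move/eqP: w2; rewrite eqf_sqr => /orP[/eqP w|/eqP w].
- by exists (z1 - r1); split=> //; [rewrite mulrBl; lra|ring].
- by exists (z1 + r1); split=> //; [rewrite mulrDl; lra|ring].
Qed.

Lemma dense_slopes_sym (R : realType) (Z1 Z2 : R -> R -> Prop) :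
  dense_slopes (fun t q => Z1 t q /\ Z2 t q) ->
  dense_slopes (fun t q => Z2 t q /\ Z1 t q).
Proof. by move=> dense P hP; apply: dense => t q [h1 h2]; apply: (hP t). Qed.

(** A sphere touching the horizontal plane at height [g] on [l1] has a
   tangency form divisible by [t - g], with a cofactor linear in [t]. If
   [g1] and [g2] differ, each common solution kills both a factor of the
   first form and a factor of the second, and eliminating [t] from the three
   possible pairs gives the three polynomials below. One of them vanishes
   identically, which makes [l1] perpendicular to the horizontal planes. A
   sphere touching such a plane on [l1] is then centred on [l1] and touches
   two of them there, at heights symmetric about its centre, and the
   vanishing polynomial says that one of the two heights of the first sphere
   is one of the two heights of the second. *)
Lemma touching_pair (R : realType) (e x1 y1 z1 r1 x2 y2 z2 r2 g1 g2 : R) :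
  dense_slopes (fun t q => tangency_form e x1 y1 z1 r1 t 1 q = 0 /\
                           tangency_form e x2 y2 z2 r2 t 1 q = 0) ->
  touches e x1 y1 z1 r1 g1 -> touches e x2 y2 z2 r2 g2 ->
  exists g, touches e x1 y1 z1 r1 g /\ touches e x2 y2 z2 r2 g.
Proof.
move=> dense T1 T2; have [gE|ng] := eqVneq g1 g2.
  by exists g1; split=> //; rewrite gE.
case: T1 T2 => x10 y1E r1E [x20 y2E r2E].
have dg : g1 - g2 != 0 by rewrite subr_eq0.
have lin (c k : R) : c%:P + k *: (1 + 'X^2) = 0 -> c = 0 /\ k = 0.
  move=> h.
  have h0 : (c%:P + k *: (1 + 'X^2)).[0] = 0 by rewrite h horner0.
  have h1 : (c%:P + k *: (1 + 'X^2)).[1] = 0 by rewrite h horner0.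
  by move: h0 h1; rewrite !hornerE => h0 h1; split; lra.
(* In each of the three polynomials below, the constant is [e ^+ 2] times
   [g1 - g2] up to sign. *)
have e0 (c : R) : e ^+ 2 * c = 0 -> c != 0 -> e = 0.
  by move=> /eqP; rewrite mulf_eq0 sqrf_eq0 => /orP[/eqP//|->].
pose F1 : {poly R} := (e ^+ 2 * (g1 - g2))%:P
                      + (g1 + g2 - 2 * z2) *: (1 + 'X^2).
pose F2 : {poly R} := (e ^+ 2 * (g2 - g1))%:P
                      + (g1 + g2 - 2 * z1) *: (1 + 'X^2).
pose F3 : {poly R} := (e ^+ 2 * (g1 - g2))%:P
                      + ((2 * z1 - g1) - (2 * z2 - g2)) *: (1 + 'X^2).
have F0 : F1 * F2 * F3 = 0.
  apply: dense => t q [f1 f2].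
  have {f1} :
      (t - g1) * (e ^+ 2 * (t - g1) + (t + g1 - 2 * z1) * (1 + q ^+ 2)) = 0.
    by rewrite -f1 /tangency_form -r1E x10 y1E; ring.
  have {f2} :
      (t - g2) * (e ^+ 2 * (t - g2) + (t + g2 - 2 * z2) * (1 + q ^+ 2)) = 0.
    by rewrite -f2 /tangency_form -r2E x20 y2E; ring.
  move=> /eqP; rewrite mulf_eq0 subr_eq0 => f2.
  move=> /eqP; rewrite mulf_eq0 subr_eq0 => f1.
  rewrite !rootM /root /F1 /F2 /F3 !hornerE /=.
  case/orP: f1 => [/eqP tE|/eqP f1]; case/orP: f2 => [/eqP tE'|/eqP f2].
  - by case/eqP: ng; rewrite -tE tE'.
  - by rewrite -tE (addrC t g2 ) -f2 (addrC g2 t) eqxx.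
  - apply/orP; left; apply/orP; right; rewrite -tE' -f1.
    by apply/eqP; ring.
  - apply/orP; right; rewrite -[X in _ == X](subrr 0) -{1}f2 -f1.
    by apply/eqP; ring.
move/eqP: F0; rewrite !mulf_eq0 -orbA => /or3P[]/eqP/lin[c0 k0].
- have E : e = 0 by apply: e0 c0 dg.
  exists g1; split; split=> //; first by rewrite y2E E !mulr0.
  by rewrite -r2E; have -> : g1 = 2 * z2 - g2 by [lra]; ring.
- have E : e = 0 by apply: e0 c0 _; rewrite -opprB oppr_eq0.
  exists g2; split; split=> //; first by rewrite y1E E !mulr0.
  by rewrite -r1E; have -> : g2 = 2 * z1 - g1 by [lra]; ring.
- have E : e = 0 by apply: e0 c0 dg.
  exists (2 * z1 - g1); split; split; rewrite ?y1E ?y2E ?E ?mulr0//.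
    by rewrite -r1E; ring.
  by rewrite -r2E; have -> : 2 * z1 - g1 = 2 * z2 - g2 by [lra]; ring.
Qed.

(** If the equations have the same linear coefficient in [t], their constant
   coefficients agree as well. Put [w1 = x1 + y1 * i] and
   [w2 = x2 + y2 * i]. Comparing the coefficients of [q] gives equal
   imaginary parts of [w1 ^+ 2] and [w2 ^+ 2], and those of [q ^+ 2] and 1
   together give equal real parts. So [w2] is [w1] or [- w1], and
   [w2 = - w1 <> w1] is only compatible with [e = 0]. *)
Lemma eq_polar_dense (R : realType) (e x1 y1 z1 r1 x2 y2 z2 r2 : R) :
  dense_slopes (fun t q => tangency_form e x1 y1 z1 r1 t 1 q = 0 /\
                           tangency_form e x2 y2 z2 r2 t 1 q = 0) ->
  polar_poly e x1 y1 z1 = polar_poly e x2 y2 z2 ->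
  [/\ x1 = x2, y1 = y2, z1 = z2 & r1 ^+ 2 = r2 ^+ 2] \/
  [/\ e = 0, x2 = - x1, y2 = - y1, z1 = z2 & r1 ^+ 2 = r2 ^+ 2].
Proof.
move=> dense polE.
have polq q : (polar_poly e x1 y1 z1).[q] = (polar_poly e x2 y2 z2).[q].
  by rewrite polE.
have C0 : const_poly x1 y1 z1 r1 - const_poly x2 y2 z2 r2 = 0.
  apply: dense => t q [f1 f2]; have := polq q.
  rewrite /root /polar_poly /const_poly !hornerE /= => pq.
  rewrite -[X in _ == X](subrr 0) -{1}f1 -f2 /tangency_form; apply/eqP.
  by have := congr1 (fun x => 2 * t * x) pq; lra.
have Cq q : (const_poly x1 y1 z1 r1).[q] = (const_poly x2 y2 z2 r2).[q].
  by move/eqP: C0; rewrite subr_eq0 => /eqP->.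
move: (polq 0) (polq 1) (polq (-1)) (Cq 0) (Cq 1) (Cq (-1)).
rewrite /polar_poly /const_poly !hornerE /= => p0 p1 pm k0 k1 km.
have zE : z1 = z2 by lra.
rewrite -{}zE in p0 p1 pm k0 k1 km *.
have exE : e * (x1 - x2) = 0 by lra.
have eyE : e * (y1 - y2) = 0 by lra.
have xyE : x1 * y1 = x2 * y2 by lra.
have xE : x1 ^+ 2 - x2 ^+ 2 = r1 ^+ 2 - r2 ^+ 2 by lra.
have yE : y1 ^+ 2 - y2 ^+ 2 = r1 ^+ 2 - r2 ^+ 2 by lra.
have k00 : r1 ^+ 2 - r2 ^+ 2 = 0.
  (* This is the equality of [|w1 ^+ 2| ^+ 2] and [|w2 ^+ 2| ^+ 2]. *)
  have : (x1 ^+ 2 + y1 ^+ 2) ^+ 2 == (x2 ^+ 2 + y2 ^+ 2) ^+ 2.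
    have E (x y : R) : (x ^+ 2 + y ^+ 2) ^+ 2
        = (x ^+ 2 - y ^+ 2) ^+ 2 + 4 * (x * y) ^+ 2 by ring.
    rewrite !E xyE (_ : x1 ^+ 2 - y1 ^+ 2 = x2 ^+ 2 - y2 ^+ 2)//; lra.
  by rewrite eqrXn2// ?addr_ge0 ?sqr_ge0// => /eqP; lra.
have rE : r1 ^+ 2 = r2 ^+ 2 by lra.
move: xE yE; rewrite k00 => /eqP + /eqP.
rewrite !subr_eq0 !eqf_sqr => /orP[]/eqP xE /orP[]/eqP yE.
- by left.
- have [y0|y0] := eqVneq y2 0; first by left; split=> //; rewrite yE y0 oppr0.
  right; have x0 : x1 = 0.
    by apply/eqP; rewrite -(mulIr_eq0 _ (mulIf y0)); apply/eqP; nra.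
  have e0 : e = 0.
    apply/eqP; rewrite -(mulIr_eq0 _ (mulIf y0)); apply/eqP; nra.
  by split; rewrite // -?xE ?x0 ?oppr0// yE opprK.
- have [x0|x0] := eqVneq x2 0; first by left; split=> //; rewrite xE x0 oppr0.
  right; have y0 : y1 = 0.
    by apply/eqP; rewrite -(mulIr_eq0 _ (mulIf x0)); apply/eqP; nra.
  have e0 : e = 0.
    apply/eqP; rewrite -(mulIr_eq0 _ (mulIf x0)); apply/eqP; nra.
  by split; rewrite // -?yE ?y0 ?oppr0// xE opprK.
- have [e0|e0] := eqVneq e 0; first by right; rewrite xE yE !opprK.
  left; have /eqP := exE; have /eqP := eyE.
  by rewrite !mulf_eq0 (negPf e0) !subr_eq0 => /eqP-> /eqP->.
Qed.

Lemma dense_slopes_cases (R : realType) (e x1 y1 z1 r1 x2 y2 z2 r2 : R) :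
  r1 != 0 -> r2 != 0 ->
  dense_slopes (fun t q => tangency_form e x1 y1 z1 r1 t 1 q = 0 /\
                           tangency_form e x2 y2 z2 r2 t 1 q = 0) ->
  [\/ exists g, touches e x1 y1 z1 r1 g /\ touches e x2 y2 z2 r2 g,
      [/\ x1 = x2, y1 = y2, z1 = z2 & r1 ^+ 2 = r2 ^+ 2]
    | [/\ e = 0, x2 = - x1, y2 = - y1, z1 = z2 & r1 ^+ 2 = r2 ^+ 2]].
Proof.
move=> r10 r20 dense.
have [/eq_polar_dense|neq] := eqVneq
  (polar_poly e x1 y1 z1) (polar_poly e x2 y2 z2).
  by move=> /(_ _ _ dense)[]; [constructor 2|constructor 3].
constructor 1; have [g1 T1] := touches_of_dense r10 dense neq.
have [|g2 T2] := touches_of_dense r20 (dense_slopes_sym dense).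
  by rewrite eq_sym.
exact: touching_pair dense T1 T2.
Qed.

(** * From infinitely many lines to polynomial identities and back *)

Lemma transversal_line_scale (R : realType) (a : 'rV[R]_3) F e t p q k :
  F *m F^T = 1%:M -> k != 0 -> p ^+ 2 + q ^+ 2 != 0 ->
  transversal_line a F e t p q = transversal_line a F e t (k * p) (k * q).
Proof.
move=> FF k0 pq0; apply: span_line_eq.
- by apply: line_span_line; rewrite vec3_pq_eq0.
- rewrite vec3_pq_eq0// !exprMn -mulrDr mulf_eq0 negb_or pq0 andbT.
  by rewrite expf_neq0.
- by apply/finpt_span_line; exists 0; rewrite scale0r addr0.
- by apply/infpt_span_line; exists k; rewrite vec3Z mulr0.
Qed.

Lemma tangency_form_scale (R : realType) (e x y z r t p q k : R) :
  tangency_form e x y z r t (k * p) (k * q)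
  = k ^+ 2 * tangency_form e x y z r t p q.
Proof. by rewrite /tangency_form; ring. Qed.

(** The form is a polynomial in [t] with leading coefficient
   [(e * p) ^+ 2 + (p ^+ 2 + q ^+ 2)], which is positive. *)
Lemma tangency_form_finite (R : realType) (e x y z r p q : R) :
  p ^+ 2 + q ^+ 2 != 0 ->
  exists s : seq R, forall t, tangency_form e x y z r t p q = 0 -> t \in s.
Proof.
move=> pq0.
pose P : {poly R} := (p *: (e *: 'X - y%:P) + (x * q)%:P) ^+ 2
  + (p ^+ 2 + q ^+ 2) *: (('X - z%:P) ^+ 2 - (r ^+ 2)%:P).
have PE t : P.[t] = tangency_form e x y z r t p q.
  by rewrite /P /tangency_form !hornerE /=; ring.
have [|s hs] := @poly_roots_finite _ P.
  apply: contraNneq pq0 => P0.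
  have Pt t : tangency_form e x y z r t p q = 0 by rewrite -PE P0 horner0.
  have A0 : (e * p) ^+ 2 + (p ^+ 2 + q ^+ 2) = 0.
    (* The second difference of a quadratic polynomial is twice its leading
       coefficient. *)
    by move: (Pt 1) (Pt (-1)) (Pt 0); rewrite /tangency_form => *; lra.
  rewrite eq_le (addr_ge0 (sqr_ge0 _) (sqr_ge0 _)) andbT -A0.
  by rewrite lerDr sqr_ge0.
by exists s => t f0; apply: hs; rewrite /root PE f0.
Qed.

(** Each direction carries only finitely many tangent transversals. If the
   slopes [q / p] all were roots of a nonzero polynomial, there would be
   finitely many directions, counting the direction [0 : 1], and hence
   finitely many lines. *)
Lemma infinite_dense_slopes (R : realType) (l1 l2 : {vspace 'rV[R]_(3 + 1)})
  a F e
  x1 y1 z1 r1 x2 y2 z2 r2 :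
  adapted_frame l1 l2 a F e -> skew_lines l1 l2 -> 0 <= r1 -> 0 <= r2 ->
  infinite_set (common_tangents l1 l2 (a + vec3 F x1 y1 z1) r1
                                      (a + vec3 F x2 y2 z2) r2) ->
  dense_slopes (fun t q => tangency_form e x1 y1 z1 r1 t 1 q = 0 /\
                           tangency_form e x2 y2 z2 r2 t 1 q = 0).
Proof.
move=> fr skew r10 r20 inf P hP; have FF := adapted_orthonormal fr.
have [//|P0] := eqVneq P 0; have [s hs] := poly_roots_finite P0.
have /choice[ts hts] (pq : R * R) : exists l : seq R,
    pq.1 ^+ 2 + pq.2 ^+ 2 != 0 ->
    forall t, tangency_form e x1 y1 z1 r1 t pq.1 pq.2 = 0 -> t \in l.
  have [pq0|/tangency_form_finite h] := eqVneq (pq.1 ^+ 2 + pq.2 ^+ 2) 0.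
    by exists [::].
  by have [l hl] := h e x1 y1 z1 r1; exists l.
pose ms : seq (R * R) := (0, 1) :: [seq (1, q) | q <- s].
pose Ls := [seq transversal_line a F e t pq.1 pq.2 | pq <- ms, t <- ts pq].
exfalso; apply: inf; apply: sub_finite_set (finite_seq Ls) => L.
move=> /(common_tangentsP _ _ _ _ _ _ _ fr skew r10 r20).
move=> [t [p [q [pq0 -> f1 f2]]]].
(* Rescaling by [k] brings the direction to the form [1 : q] or [0 : 1]. *)
pose k := if p == 0 then q^-1 else p^-1.
have k0 : k != 0.
  rewrite /k; case: (eqVneq p 0) => [p0|p0]; rewrite invr_eq0//.
  by apply: contraNneq pq0 => ->; rewrite p0 !expr0n addr0.
have kpq0 : (k * p) ^+ 2 + (k * q) ^+ 2 != 0.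
  by rewrite !exprMn -mulrDr mulf_neq0// expf_neq0.
have kms : (k * p, k * q) \in ms.
  rewrite inE; have [p0|p0] := eqVneq p 0.
    rewrite p0 mulr0 /k p0 eqxx mulVf ?eqxx//.
    by apply: contraNneq pq0 => ->; rewrite p0 !expr0n addr0.
  have kp : k * p = 1 by rewrite /k (negPf p0) mulVf.
  rewrite kp; apply/orP; right; apply: map_f; apply: hs; apply: (hP t).
  by split; rewrite -kp tangency_form_scale ?f1 ?f2 mulr0.
rewrite /= (transversal_line_scale _ _ _ FF k0 pq0).
apply/allpairsPdep; exists (k * p, k * q), t; split=> //=.
by apply: (hts (k * p, k * q)) => //=; rewrite tangency_form_scale f1 mulr0.
Qed.

Lemma infinite_common_tangents (R : realType) (l1 l2 : {vspace 'rV[R]_(3 + 1)})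
  a F e
  x1 y1 z1 r1 x2 y2 z2 r2 (t p q : nat -> R) :
  adapted_frame l1 l2 a F e -> skew_lines l1 l2 -> 0 <= r1 -> 0 <= r2 ->
  (forall k, [/\ p k ^+ 2 + q k ^+ 2 != 0,
    tangency_form e x1 y1 z1 r1 (t k) (p k) (q k) = 0 &
    tangency_form e x2 y2 z2 r2 (t k) (p k) (q k) = 0]) ->
  (forall k k', p k * q k' = p k' * q k -> k = k') ->
  infinite_set (common_tangents l1 l2 (a + vec3 F x1 y1 z1) r1
                                      (a + vec3 F x2 y2 z2) r2).
Proof.
move=> fr skew r10 r20 sol inj fin; have FF := adapted_orthonormal fr.
pose f k := transversal_line a F e (t k) (p k) (q k).
apply: infinite_nat.
apply: (sub_finite_set _ (finite_preimage (f := f) _ fin)) => [k _|k k' _ _ fE].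
  apply/(common_tangentsP _ _ _ _ _ _ _ fr skew r10 r20).
  by have [pq0 f1 f2] := sol k; exists (t k), (p k), (q k).
have : infpt (vec3 F (p k) (q k) 0) \in f k'.
  by rewrite -fE; apply/infpt_span_line; exists 1; rewrite scale1r.
move=> /infpt_span_line[s]; rewrite vec3Z => /(vec3_inj FF)[pE qE _].
by apply: inj; rewrite pE qE; ring.
Qed.

(** * The two exceptional configurations in coordinates *)

(** The line [l2] is the line at infinity of every horizontal plane. *)
Lemma adapted_line_at_infinity_plane (R : realType)
  (l1 l2 : {vspace 'rV[R]_(3 + 1)}) a F e p :
  adapted_frame l1 l2 a F e ->
  l2 = (plane p (vec3 F 0 0 1) :&: plane_at_infinity R)%VS.
Proof.
move=> fr; have FF := adapted_orthonormal fr.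
apply/vspaceP => w; rewrite memv_cap; apply/idP/andP.
  move=> /(mem_adapted_line_at_infinity _ fr)[s [t ->]].
  rewrite infpt_plane_at_infinity infptE mem_plane dot_vec3//.
  by rewrite !mulr0 !mul0r !add0r.
move=> [+ /infpt_of_mem[v wE]]; rewrite wE infptE mem_plane mul0r => /eqP v3.
apply/(mem_adapted_line_at_infinity _ fr).
exists (dot v (row 0 F)), (dot v (row 1 F)).
rewrite -infptE; congr infpt; rewrite {1}(vec3_coord v FF); congr vec3.
by rewrite -v3; congr dot; apply/rowP => j; rewrite !mxE; ring.
Qed.

Lemma finpt_adapted_line (R : realType) (l1 l2 : {vspace 'rV[R]_(3 + 1)})
  a F e t :
  adapted_frame l1 l2 a F e -> finpt (a + vec3 F 0 (t * e) t) \in l1.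
Proof.
move=> fr; rewrite (adapted_line fr); apply/finpt_span_line; exists t.
by rewrite vec3Z !mulr0 mulr1.
Qed.

Lemma touches_tangency_case (R : realType) (l1 l2 : {vspace 'rV[R]_(3 + 1)})
  a F e
  x1 y1 z1 r1 x2 y2 z2 r2 g :
  adapted_frame l1 l2 a F e -> 0 < r1 -> 0 < r2 ->
  touches e x1 y1 z1 r1 g -> touches e x2 y2 z2 r2 g ->
  tangency_case l1 l2 (a + vec3 F x1 y1 z1) r1 (a + vec3 F x2 y2 z2) r2
    (a + vec3 F 0 (g * e) g).
Proof.
move=> fr r10 r20; have FF := adapted_orthonormal fr.
pose p := a + vec3 F 0 (g * e) g.
have normal x y z r : 0 < r -> touches e x y z r g ->
    [/\ sphere (a + vec3 F x y z) r p
      & tangent_plane (a + vec3 F x y z) p = plane p (vec3 F 0 0 1)].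
  move=> r0 [-> -> rE].
  have nE : p - (a + vec3 F 0 (g * e) z) = (g - z) *: vec3 F 0 0 1.
    rewrite opprD addrACA subrr add0r vec3N vec3D vec3Z.
    by congr vec3; ring.
  split.
    by apply/sphereP; [exact: ltW|rewrite nE dotZl dotZr dot_vec3// -rE; ring].
  have gz : g - z != 0.
    have : (g - z) ^+ 2 != 0 by rewrite rE sqrf_eq0; exact: lt0r_neq0.
    by rewrite sqrf_eq0.
  by rewrite /tangent_plane nE; exact: plane_scale gz.
move=> /(normal _ _ _ _ r10)[s1 t1] /(normal _ _ _ _ r20)[s2 t2].
split.
- exact: And3 s1 s2 (etrans t1 (esym t2)).
- exact: (finpt_adapted_line g fr).
- by rewrite t1; apply: adapted_line_at_infinity_plane fr.
Qed.

Lemma tangency_case_touches (R : realType) (l1 l2 : {vspace 'rV[R]_(3 + 1)})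
  p F e
  x1 y1 z1 r1 x2 y2 z2 r2 :
  adapted_frame l1 l2 p F e -> 0 < r1 -> 0 < r2 ->
  tangency_case l1 l2 (p + vec3 F x1 y1 z1) r1 (p + vec3 F x2 y2 z2) r2 p ->
  touches e x1 y1 z1 r1 0 /\ touches e x2 y2 z2 r2 0.
Proof.
move=> fr r10 r20; have FF := adapted_orthonormal fr.
have normal x y z r : 0 < r -> sphere (p + vec3 F x y z) r p ->
    l2 = (tangent_plane (p + vec3 F x y z) p :&: plane_at_infinity R)%VS ->
    touches e x y z r 0.
  move=> r0 /(sphereP _ _ (ltW r0)); rewrite opprD addrA subrr add0r vec3N.
  rewrite dot_vec3// => rE l2E.
  have orth s t : s * x + t * y = 0.
    have : infpt (vec3 F s t 0) \in l2.
      by apply/(mem_adapted_line_at_infinity _ fr); exists s, t.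
    rewrite l2E memv_cap => /andP[+ _].
    rewrite infptE mem_plane opprD addrA subrr add0r vec3N dot_vec3// !mul0r.
    by move/eqP; lra.
  have x0 : x = 0 by have := orth 1 0; lra.
  have y0 : y = 0 by have := orth 0 1; lra.
  by split; rewrite ?mul0r// -rE x0 y0; ring.
move=> [[s1 s2 tE] _ l2E]; split; first exact: (normal _ _ _ _ r10 s1 l2E).
by rewrite tE in l2E; exact: (normal _ _ _ _ r20 s2 l2E).
Qed.

Lemma half_turn_sphere (R : realType) (a : 'rV[R]_3) F x y z r :
  F *m F^T = 1%:M -> 0 <= r ->
  half_turn_image (span_line a (vec3 F 0 0 1)) (sphere (a + vec3 F x y z) r)
  = sphere (a + vec3 F (- x) (- y) z) r.
Proof.
move=> FF r0.
have sphE X Y Z x' y' z' : sphere (a + vec3 F x' y' z') r (a + vec3 F X Y Z) <->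
    (X - x') ^+ 2 + (Y - y') ^+ 2 + (Z - z') ^+ 2 = r ^+ 2.
  by rewrite (sphereP _ _ r0) opprD addrACA subrr add0r vec3N vec3D dot_vec3.
apply/seteqP; split=> w.
  move=> [w' [q [+ /finpt_span_line[s ->] + ->]]].
  have [X [Y [Z ->]]] := point_coord a w' FF => /sphE wS.
  have -> : a + vec3 F X Y Z - (a + s *: vec3 F 0 0 1) = vec3 F X Y (Z - s).
    rewrite opprD addrACA subrr add0r vec3Z vec3N vec3D; congr vec3; ring.
  move=> /(_ (vec3 F 0 0 1)); rewrite infpt_span_line dot_vec3//.
  move=> /(_ _)/wrap[]; first by exists 1; rewrite scale1r.
  move=> Zs; rewrite vec3Z -addrA vec3N vec3D; apply/sphE; rewrite -wS.
  have -> : s = Z by lra.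
  ring.
have [X [Y [Z ->]]] := point_coord a w FF => /sphE wS.
exists (a + vec3 F (- X) (- Y) Z), (a + Z *: vec3 F 0 0 1).
have dE : a + vec3 F (- X) (- Y) Z - (a + Z *: vec3 F 0 0 1)
    = vec3 F (- X) (- Y) 0.
  rewrite opprD addrACA subrr add0r vec3Z vec3N vec3D; congr vec3; ring.
split.
- by apply/sphE; rewrite -wS; ring.
- by apply/finpt_span_line; exists Z.
- move=> v /infpt_span_line[s ->]; rewrite dE dotZr dot_vec3//; ring.
- rewrite dE vec3Z -addrA vec3N vec3D; congr (_ + vec3 _ _ _ _); ring.
Qed.

Lemma half_turn_caseP (R : realType) (l1 l2 : {vspace 'rV[R]_(3 + 1)})
  a F e
  x1 y1 z1 r1 x2 y2 z2 r2 :
  adapted_frame l1 l2 a F e -> skew_lines l1 l2 -> 0 < r1 -> 0 < r2 ->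
  half_turn_case l1 l2 (a + vec3 F x1 y1 z1) r1 (a + vec3 F x2 y2 z2) r2 <->
  [/\ e = 0, x2 = - x1, y2 = - y1, z1 = z2 & r1 = r2].
Proof.
move=> fr skew r10 r20; have FF := adapted_orthonormal fr; split.
  move=> [perp sphE]; have e0 : e = 0.
    (* The transversal through [a] in the direction of the projection of [l1]
       to the horizontal planes is perpendicular to [l1] only if that
       projection is a point. *)
    pose L := transversal_line a F e 0 0 1.
    have [|finL L1 L2] := (transversal_lineP L fr skew).2.
      by exists 0, 0, 1; rewrite expr0n add0r expr1n oner_eq0.
    have vL : infpt (vec3 F 0 1 0) \in L.
      by apply/infpt_span_line; exists 1; rewrite scale1r.
    have ul1 : infpt (vec3 F 0 e 1) \in l1.
      rewrite (adapted_line fr); apply/infpt_span_line; exists 1.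
      by rewrite scale1r.
    by have := perp L finL L1 L2 _ _ vL ul1; rewrite dot_vec3//; lra.
  move: sphE; rewrite (adapted_line fr) e0 half_turn_sphere ?ltW//.
  move=> /(sphere_inj r20 r10)[/addrI/(vec3_inj FF)[-> -> ->] ->].
  by split.
move=> [e0 -> -> -> ->]; split; last first.
  by rewrite (adapted_line fr) e0 half_turn_sphere ?ltW.
move=> L finL L1 L2 v w.
have [t [p [q [_ ->]]]] := (transversal_lineP L fr skew).1 (And3 finL L1 L2).
rewrite (adapted_line fr) e0 => /infpt_span_line[s ->] /infpt_span_line[s' ->].
by rewrite !vec3Z dot_vec3//; ring.
Qed.

(** Both tangency forms coincide. The line through [l1] in the direction of
   the centre [(x, y)], turned by an angle of tangent [s], is at distance at
   most [r] from the axis through the centre parallel to [l1] as soon as [s]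
   is small, and then some height [t] makes it tangent. *)
Lemma half_turn_infinite (R : realType) (l1 l2 : {vspace 'rV[R]_(3 + 1)}) a F
  x y z r :
  adapted_frame l1 l2 a F 0 -> skew_lines l1 l2 -> 0 < r ->
  x ^+ 2 + y ^+ 2 != 0 ->
  infinite_set (common_tangents l1 l2 (a + vec3 F x y z) r
                                      (a + vec3 F (- x) (- y) z) r).
Proof.
move=> fr skew r0; set N := x ^+ 2 + y ^+ 2 => N0.
have N_gt0 : 0 < N by rewrite lt_neqAle eq_sym N0 addr_ge0 ?sqr_ge0.
(* The factor [1 + N] makes [s k ^+ 2 * N <= r ^+ 2] without a square root. *)
pose s (k : nat) := r / (1 + N) / k.+1%:R.
pose t k := z + Num.sqrt (r ^+ 2 - s k ^+ 2 * N / (1 + s k ^+ 2)).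
have s1 k : 0 < 1 + s k ^+ 2 by rewrite ltr_wpDr ?sqr_ge0.
have tE k : (t k - z) ^+ 2 = r ^+ 2 - s k ^+ 2 * N / (1 + s k ^+ 2).
  rewrite /t addrC addKr sqr_sqrtr// subr_ge0 ler_pdivrMr//.
  have sN : s k ^+ 2 * N <= r ^+ 2.
    have sE : s k * (1 + N) = r / k.+1%:R.
      rewrite /s; field.
      by rewrite nat1r pnatr_eq0 /= gt_eqF// ltr_wpDr// ltW.
    have : (s k * (1 + N)) ^+ 2 <= r ^+ 2.
      have sr : r / k.+1%:R <= r.
        by rewrite ler_pdivrMr ?ltr0n// ler_peMr ?ler1n// ltW.
      rewrite sE; apply: lerXn2r sr;
        by rewrite nnegrE ?divr_ge0 ?ler0n ?(ltW r0).
    move=> h; apply: (le_trans _ h); rewrite [leRHS]exprMn ler_wpM2l ?sqr_ge0//.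
    by have := sqr_ge0 N; lra.
  by apply: (le_trans sN); rewrite ler_peMr ?sqr_ge0// lerDl sqr_ge0.
apply: (@infinite_common_tangents _ l1 l2 a F 0 _ _ _ _ _ _ _ _ t
  (fun k => x - s k * y) (fun k => y + s k * x)) => //; try exact: ltW.
- move=> k.
  have pqE : (x - s k * y) ^+ 2 + (y + s k * x) ^+ 2 = N * (1 + s k ^+ 2).
    by rewrite /N; ring.
  rewrite /tangency_form !pqE tE; split.
  + by rewrite mulf_neq0// gt_eqF.
  + by rewrite /N; field; rewrite gt_eqF.
  + by rewrite /N; field; rewrite gt_eqF.
- move=> k k' E.
  have /eqP : N * (s k' - s k) = 0.
    by move/eqP: E; rewrite -subr_eq0 /N => /eqP <-; ring.
  rewrite mulf_eq0 (negPf N0) subr_eq0 /s => /eqP/mulfI E'.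
  have /invr_inj/eqP : (k'.+1%:R : R)^-1 = k.+1%:R^-1.
    by apply: E'; rewrite mulf_neq0 ?invr_eq0 ?gt_eqF// ltr_wpDr// ltW.
  by rewrite eqr_nat => /eqP[].
Qed.

(** * The classification *)

Lemma infinite_classification (R : realType) (l1 l2 : {vspace 'rV[R]_(3 + 1)})
  c1 r1 c2 r2 :
  0 < r1 -> 0 < r2 -> sphere c1 r1 <> sphere c2 r2 ->
  finite_line l1 -> line_at_infinity l2 -> skew_lines l1 l2 ->
  infinite_set (common_tangents l1 l2 c1 r1 c2 r2) ->
  (exists p, tangency_case l1 l2 c1 r1 c2 r2 p) \/
  half_turn_case l1 l2 c1 r1 c2 r2.
Proof.
move=> r10 r20 hS hl1 hl2 skew inf.
have [a al1] := finite_line_point hl1.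
have [F [e fr]] := exists_adapted_frame hl1 hl2 skew al1.
have FF := adapted_orthonormal fr.
have [x1 [y1 [z1 c1E]]] := point_coord a c1 FF.
have [x2 [y2 [z2 c2E]]] := point_coord a c2 FF.
move: hS inf; rewrite c1E c2E => hS inf.
have r12 : r1 ^+ 2 = r2 ^+ 2 -> r1 = r2.
  by move=> /eqP; rewrite eqrXn2 ?ltW// => /eqP.
have dense := infinite_dense_slopes fr skew (ltW r10) (ltW r20) inf.
have [[g [T1 T2]]|[xE yE zE /r12 rE]|[e0 xE yE zE /r12 rE]] :=
  dense_slopes_cases (lt0r_neq0 r10) (lt0r_neq0 r20) dense.
- by left; eexists; exact: (touches_tangency_case fr r10 r20 T1 T2).
- by case: hS; rewrite xE yE zE rE.
- by right; apply/(half_turn_caseP _ _ _ _ _ _ fr skew r10 r20).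
Qed.

Lemma tangency_case_infinite (R : realType) (l1 l2 : {vspace 'rV[R]_(3 + 1)})
  c1 r1 c2 r2 p :
  0 < r1 -> 0 < r2 ->
  finite_line l1 -> line_at_infinity l2 -> skew_lines l1 l2 ->
  tangency_case l1 l2 c1 r1 c2 r2 p ->
  infinite_set (common_tangents l1 l2 c1 r1 c2 r2).
Proof.
move=> r10 r20 hl1 hl2 skew tc.
have pl1 : finpt p \in l1 by case: tc.
have [F [e fr]] := exists_adapted_frame hl1 hl2 skew pl1.
have FF := adapted_orthonormal fr.
have [x1 [y1 [z1 c1E]]] := point_coord p c1 FF.
have [x2 [y2 [z2 c2E]]] := point_coord p c2 FF.
move: tc; rewrite c1E c2E => /(tangency_case_touches fr r10 r20)[T1 T2].
apply: (infinite_common_tangents (t := fun=> 0) (p := fun=> 1)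
  (q := fun k => k%:R) fr skew (ltW r10) (ltW r20)) => [k|k k'].
  rewrite /tangency_form; case: T1 => -> -> <-; case: T2 => -> -> <-.
  by split; try ring; rewrite gt_eqF// expr1n ltr_wpDr ?sqr_ge0.
by rewrite !mul1r => /eqP; rewrite eqr_nat => /eqP.
Qed.

Lemma half_turn_case_infinite (R : realType) (l1 l2 : {vspace 'rV[R]_(3 + 1)})
  c1 r1 c2 r2 :
  0 < r1 -> 0 < r2 -> sphere c1 r1 <> sphere c2 r2 ->
  finite_line l1 -> line_at_infinity l2 -> skew_lines l1 l2 ->
  half_turn_case l1 l2 c1 r1 c2 r2 ->
  infinite_set (common_tangents l1 l2 c1 r1 c2 r2).
Proof.
move=> r10 r20 hS hl1 hl2 skew.
have [a al1] := finite_line_point hl1.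
have [F [e fr]] := exists_adapted_frame hl1 hl2 skew al1.
have FF := adapted_orthonormal fr.
have [x1 [y1 [z1 c1E]]] := point_coord a c1 FF.
have [x2 [y2 [z2 c2E]]] := point_coord a c2 FF.
move: hS; rewrite c1E c2E => hS.
move=> /(half_turn_caseP _ _ _ _ _ _ fr skew r10 r20)[e0 xE yE zE rE].
rewrite e0 in fr; rewrite xE yE -zE -rE.
apply: half_turn_infinite fr skew r10 _; apply/eqP => N0; apply: hS.
move/eqP: N0; rewrite paddr_eq0 ?sqr_ge0// !sqrf_eq0 => /andP[/eqP x0 /eqP y0].
by rewrite xE yE zE rE x0 y0 oppr0.
Qed.

(** With the origin at [p], both centres lie on the normal through [p], at
   heights [z1 <> z2]. The difference of the two tangency forms is
   [2 * t * (z2 - z1) * (s ^+ 2 + q ^+ 2)], so a common solution has height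
   0. *)
Lemma tangency_case_pencil (R : realType) (l1 l2 L : {vspace 'rV[R]_(3 + 1)})
  c1 r1 c2 r2 p :
  0 < r1 -> 0 < r2 -> sphere c1 r1 <> sphere c2 r2 ->
  finite_line l1 -> line_at_infinity l2 -> skew_lines l1 l2 ->
  tangency_case l1 l2 c1 r1 c2 r2 p ->
  common_tangents l1 l2 c1 r1 c2 r2 L <->
  [/\ line L, finpt p \in L & (L <= tangent_plane c1 p)%VS].
Proof.
move=> r10 r20 hS hl1 hl2 skew tc.
have pl1 : finpt p \in l1 by case: tc.
have [F [e fr]] := exists_adapted_frame hl1 hl2 skew pl1.
have FF := adapted_orthonormal fr.
have [x1 [y1 [z1 c1E]]] := point_coord p c1 FF.
have [x2 [y2 [z2 c2E]]] := point_coord p c2 FF.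
move: tc hS; rewrite c1E c2E => /(tangency_case_touches fr r10 r20)[].
rewrite /touches !mul0r !sub0r !sqrrN => -[-> -> z1E] [-> -> z2E] hS.
have z10 : z1 != 0 by rewrite -sqrf_eq0 z1E sqrf_eq0 lt0r_neq0.
have z12 : z1 != z2.
  apply/eqP => zE; apply: hS; rewrite zE; congr sphere.
  by apply/eqP; rewrite -(@eqrXn2 _ 2) ?ltW// -z1E -z2E zE.
have planeE : tangent_plane (p + vec3 F 0 0 z1) p = plane p (vec3 F 0 0 1).
  have nE : p - (p + vec3 F 0 0 z1) = - z1 *: vec3 F 0 0 1.
    by rewrite opprD addrA subrr add0r vec3N vec3Z; congr vec3; ring.
  rewrite /tangent_plane nE; apply: plane_scale; by rewrite oppr_eq0.
have p0 : p + vec3 F 0 (0 * e) 0 = p.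
  by rewrite /vec3 mul0r !scale0r !addr0.
rewrite planeE; split.
  move=> /(common_tangentsP _ _ _ _ _ _ _ fr skew (ltW r10) (ltW r20)).
  move=> [t [s [q [pq0 -> f1 f2]]]].
  have t0 : t = 0.
    have : t * (z1 - z2) * (s ^+ 2 + q ^+ 2) = 0.
      by move: f1 f2; rewrite /tangency_form -z1E -z2E => f1 f2; lra.
    move/eqP; rewrite !mulf_eq0 subr_eq0 (negPf z12) (negPf pq0) !orbF.
    by move/eqP.
  have v0 : vec3 F s q 0 != 0 by rewrite vec3_pq_eq0.
  rewrite t0 /transversal_line p0; split; first exact: line_span_line.
    by apply/finpt_span_line; exists 0; rewrite scale0r addr0.
  rewrite subv_add -!memvE infptE /finpt !mem_plane mul1r eqxx /=.
  by rewrite dot_vec3// !mulr0 !mul0r !addr0.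
move=> [lineL pL Lp]; have [v v0 LE] := finite_lineP lineL pL.
have : infpt v \in plane p (vec3 F 0 0 1).
  apply: (subvP Lp); rewrite LE; apply/infpt_span_line; exists 1.
  by rewrite scale1r.
have [x [y [z vE]]] := point_coord 0 v FF; rewrite add0r in vE.
rewrite infptE mem_plane mul0r vE (dot_vec3 _ _ _ _ _ _ FF).
rewrite !mulr0 !add0r mulr1 => /eqP z0.
move: LE v0; rewrite vE z0 (vec3_pq_eq0 x y FF) => LE xy0.
apply: (common_tangentsP _ _ _ _ _ _ _ fr skew (ltW r10) (ltW r20)).2.
exists 0, x, y; split; first exact: xy0.
- by rewrite LE /transversal_line p0.
- by rewrite /tangency_form -z1E; ring.
- by rewrite /tangency_form -z2E; ring.
Qed.

Theorem theorem18 (R : realType) (c1 c2 : 'rV[R]_3) (r1 r2 : R)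
  (l1 l2 : {vspace 'rV[R]_(3 + 1)})
  (hr1 : 0 < r1) (hr2 : 0 < r2)
  (hS : sphere c1 r1 <> sphere c2 r2)
  (hl1 : finite_line l1) (hl2 : line_at_infinity l2) (hskew : skew_lines l1 l2) :
  (infinite_set (common_tangents l1 l2 c1 r1 c2 r2) <->
     (exists p : 'rV[R]_3, tangency_case l1 l2 c1 r1 c2 r2 p)
     \/ half_turn_case l1 l2 c1 r1 c2 r2)
  /\ (forall p : 'rV[R]_3, tangency_case l1 l2 c1 r1 c2 r2 p ->
        forall L : {vspace 'rV[R]_(3 + 1)},
          common_tangents l1 l2 c1 r1 c2 r2 L <->
          [/\ line L, finpt p \in L & (L <= tangent_plane c1 p)%VS]).
Proof.
split; last by move=> p tc L; exact: tangency_case_pencil.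
split; first exact: infinite_classification.
move=> [[p tc]|ht]; first exact: tangency_case_infinite tc.
exact: half_turn_case_infinite.
Qed.
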